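(* Let $t>2$ be an integer, let $q\in\mathbb{C}$ be a primitive $t$-th root of unity, and let $\tilde V_q$ be the $q$-analog Virasoro-like algebra. Let $\varphi$ be a $\frac12$-derivation of $\tilde V_q$. Then there exist scalars $\alpha^{\mathbf i}\in\mathbb{C}$ ($\mathbf i\in\Gamma_1\cup\{\mathbf 0\}$) and $\alpha^{\mathbf i}_{\mathbf m}\in\mathbb{C}$ ($\mathbf m\in\Gamma_1$, $\mathbf i\in\Gamma_1\cup\{\mathbf 0\}$) such that for all $\mathbf m\in\Gamma$ $$\varphi(L_{\mathbf m})=\begin{cases}\displaystyle\sum_{\mathbf i\in\Gamma_1\cup\{\mathbf 0\}}\alpha^{\mathbf i}L_{\mathbf m+\mathbf i}, & \mathbf m\in\Gamma_2,\\[2mm] \displaystyle\sum_{\mathbf i\in\Gamma_1\cup\{\mathbf 0\}}\alpha^{\mathbf i}_{\mathbf m}L_{\mathbf m+\mathbf i}, & \mathbf m\in\Gamma_1,\end{cases}$$ where all sums are finite (only finitely many $\alpha^{\mathbf i}$ are nonzero, and for each $\mathbf m\in\Gamma_1$ only finitely many $\alpha^{\mathbf i}_{\mathbf m}$ are nonzero).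
   Context: Write $(t\mathbb{Z})^2=t\mathbb{Z}\times t\mathbb{Z}\subset\mathbb{Z}^2$, $\Gamma_1=(t\mathbb{Z})^2\setminus\{\mathbf 0\}$, $\Gamma_2=\mathbb{Z}^2\setminus(t\mathbb{Z})^2$, $\Gamma=\Gamma_1\cup\Gamma_2=\mathbb{Z}^2\setminus\{\mathbf 0\}$. The algebra $\tilde V_q$ is the complex Lie algebra with basis $\{L_{\mathbf m}\mid\mathbf m\in\Gamma\}$ and bracket $[L_{\mathbf m},L_{\mathbf n}]=\lambda(\mathbf m,\mathbf n)L_{\mathbf m+\mathbf n}$, where $\lambda(\mathbf m,\mathbf n)=q^{m_2n_1}-q^{m_1n_2}$ for $\mathbf m=(m_1,m_2)$, $\mathbf n=(n_1,n_2)$, with the convention $L_{\mathbf 0}=0$. A linear map $\varphi:L\to L$ on a Lie algebra $L$ is a $\frac12$-derivation if $\varphi([x,y])=\frac12\left([\varphi(x),y]+[x,\varphi(y)]\right)$ for all $x,y\in L$. *)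

(* Defs.v *)
From HB Require Import structures.
From mathcomp Require Import all_boot all_order all_algebra finmap.
From mathcomp Require Import complex monalg.
From mathcomp Require Import boolp classical_sets functions cardinality fsbigop.
From mathcomp Require Import reals.
From mathcomp Require Import ring.

Set Implicit Arguments.
Unset Strict Implicit.
Unset Printing Implicit Defensive.

Import Order.TTheory GRing.Theory Num.Theory.
Local Open Scope ring_scope.

Section LieAlgebras.
Variables (K : fieldType) (L : lmodType K) (br : L -> L -> L).

Record is_lie_bracket : Prop := IsLieBracket {
  lie_linearl : forall y, linear (br^~ y);
  lie_linearr : forall x, linear (br x);
  lie_alternating : forall x, br x x = 0;
  lie_jacobi : forall x y z, br x (br y z) + br y (br z x) + br z (br x y) = 0
}.

Definition half_derivation (phi : {linear L -> L}) : Prop :=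
  forall x y, phi (br x y) = 2%:R^-1 *: (br (phi x) y + br x (phi y)).

End LieAlgebras.

Notation Z2 := (int * int)%type.

Definition tZ2 (t : nat) : pred Z2 :=
  fun m => (t%:Z %| m.1)%Z && (t%:Z %| m.2)%Z.

Definition Gamma : pred Z2 := fun m => m != 0.
Definition Gamma1 (t : nat) : pred Z2 := fun m => tZ2 t m && (m != 0).
Definition Gamma2 (t : nat) : pred Z2 := fun m => ~~ tZ2 t m.

(* The index set Gamma_1 union {0}; a sum \sum_(i \in Gamma1_0 t) F i is 0 by
   convention if F has infinite support, so finiteness must be stated apart. *)
Definition Gamma1_0 (t : nat) : set Z2 :=
  ([set i | Gamma1 t i] `|` [set 0])%classic.

Lemma GammaE (t : nat) (m : Z2) : Gamma m = Gamma1 t m || Gamma2 t m.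
Proof.
rewrite /Gamma /Gamma1 /Gamma2; case: eqVneq => [->|_] /=.
  by rewrite /tZ2 /= !dvdz0.
by rewrite andbT orbN.
Qed.

(* Finitely supported functions Gamma -> K, with basis << g >>, g in Gamma. *)
Notation Vq K := {malg K[{m : Z2 | Gamma m}]}.

Section QAnalogVirasoroLike.
Variables (K : fieldType) (q : K).

(* The basis vector indexed by m in Gamma, extended by Lvec 0 = 0. *)
Definition Lvec (m : Z2) : Vq K :=
  if insub m is Some g then << g >> else 0.

Definition lambda (m n : Z2) : K := q ^ (m.2 * n.1) - q ^ (m.1 * n.2).

Definition Vq_bracket (x y : Vq K) : Vq K :=
  \sum_(m <- msupp x) \sum_(n <- msupp y)
    (x@_m * y@_n * lambda (val m) (val n)) *: Lvec (val m + val n).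

End QAnalogVirasoroLike.

Section BracketTheory.
Variables (K : fieldType) (q : K).
Local Notation V := (Vq K).
Local Notation Lv := (@Lvec K).
Local Notation br := (Vq_bracket q).
Local Notation lam := (lambda q).

Lemma Lvec0 : Lv 0 = 0.
Proof. by rewrite /Lvec insubF. Qed.

Lemma Lvec_val (g : {m : Z2 | Gamma m}) : Lv (val g) = << g >>.
Proof. by rewrite /Lvec valK. Qed.

Lemma Vq_decomp (x : V) : x = \sum_(m <- msupp x) x@_m *: Lv (val m).
Proof.
rewrite [LHS]monalgE; apply: eq_bigr => m _; rewrite Lvec_val.
by apply/malgP => k; rewrite [RHS]mcoeffZ [LHS]mcoeffU mcoeffU mulr_natr.
Qed.

Lemma Vq_bracketEw (d1 d2 : {fset {m : Z2 | Gamma m}}) (x y : V) :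
    (msupp x `<=` d1)%fset -> (msupp y `<=` d2)%fset ->
  br x y = \sum_(m <- d1) \sum_(n <- d2)
    (x@_m * y@_n * lam (val m) (val n)) *: Lv (val m + val n).
Proof.
move=> s1 s2; rewrite /Vq_bracket (big_fset_incl _ s1) /=; last first.
  move=> m _ /mcoeff_outdom xm; apply: big1 => n _.
  by rewrite xm !mul0r scale0r.
apply: eq_bigr => m _; apply: big_fset_incl s2 _ => n _ /mcoeff_outdom yn.
by rewrite yn mulr0 mul0r scale0r.
Qed.

Lemma Vq_bracket_linearl (y : V) : linear (br^~ y).
Proof.
move=> a u v /=; pose d := (msupp (a *: u + v) `|` (msupp u `|` msupp v))%fset.
have s1 : (msupp (a *: u + v) `<=` d)%fset by exact: fsubsetUl.
have s2 : (msupp u `<=` d)%fset.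
  by rewrite /d fsubsetU // fsubsetUl orbT.
have s3 : (msupp v `<=` d)%fset.
  by rewrite /d fsubsetU // fsubsetUr orbT.
have sy := fsubset_refl (msupp y).
rewrite (Vq_bracketEw s1 sy) (Vq_bracketEw s2 sy) (Vq_bracketEw s3 sy).
rewrite scaler_sumr -big_split; apply: eq_bigr => m _ /=.
rewrite scaler_sumr -big_split; apply: eq_bigr => n _ /=.
have -> : (a *: u + v)@_m = a * u@_m + v@_m by rewrite mcoeffD mcoeffZ.
by rewrite scalerA -scalerDl !mulrDl !mulrA.
Qed.

Lemma lambda_antisym m n : lam n m = - lam m n.
Proof.
by rewrite /lambda opprB [n.2 * _]mulrC [n.1 * _]mulrC.
Qed.

Lemma Vq_bracketC (x y : V) : br y x = - br x y.
Proof.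
rewrite /Vq_bracket exchange_big -sumrN; apply: eq_bigr => m _ /=.
rewrite -sumrN; apply: eq_bigr => n _.
by rewrite lambda_antisym addrC -scaleNr mulrN [y@_n * _]mulrC.
Qed.

Lemma Vq_bracket_linearr (x : V) : linear (br x).
Proof.
move=> a u v; rewrite Vq_bracketC Vq_bracket_linearl opprD -scalerN.
by rewrite (Vq_bracketC u x) (Vq_bracketC v x).
Qed.

Lemma lambdaxx m : lam m m = 0.
Proof. by rewrite /lambda mulrC subrr. Qed.

Lemma lambda0r m : lam m 0 = 0.
Proof. by rewrite /lambda !mulr0 subrr. Qed.

Lemma lambda0l m : lam 0 m = 0.
Proof. by rewrite /lambda !mul0r subrr. Qed.

Lemma Vq_bracketL m n : br (Lv m) (Lv n) = lam m n *: Lv (m + n).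
Proof.
have ms g : (msupp (<< g >> : V) `<=` [fset g])%fset by exact: msuppU_le.
have [->|m0] := eqVneq m 0.
  by rewrite Lvec0 lambda0l scale0r /Vq_bracket msupp0 big_seq_fset0.
have [->|n0] := eqVneq n 0.
  rewrite Lvec0 lambda0r scale0r /Vq_bracket; apply: big1 => i _.
  by rewrite msupp0 big_seq_fset0.
have Lval (g h : {m : Z2 | Gamma m}) :
    br (Lv (val g)) (Lv (val h)) = lam (val g) (val h) *: Lv (val g + val h).
  rewrite !Lvec_val (Vq_bracketEw (ms _) (ms _)) !big_seq_fset1.
  by rewrite mcoeffUU mcoeffUU !mul1r.
exact: (Lval (Sub m m0) (Sub n n0)).
Qed.

Lemma linear_eq0 (f : V -> V) :
  linear f -> (forall m, f (Lv m) = 0) -> forall x, f x = 0.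
Proof.
move=> lf f0; have f00 : f 0 = 0.
  by rewrite -[LHS](addrK (f 0)) -{1}[f 0]scale1r -lf scale1r addr0 subrr.
move=> x; rewrite [x]Vq_decomp.
elim: (msupp x : seq _) => [|m s IHs]; first by rewrite big_nil.
by rewrite big_cons lf f0 IHs scaler0 addr0.
Qed.

Lemma Vq_brZr a (x y : V) : br x (a *: y) = a *: br x y.
Proof.
have br0 : br x 0 = 0 by rewrite /Vq_bracket; apply: big1 => m _; rewrite msupp0 big_seq_fset0.
by rewrite -[a *: y]addr0 Vq_bracket_linearr br0 addr0.
Qed.

Lemma Vq_brDr (x y z : V) : br x (y + z) = br x y + br x z.
Proof. by rewrite -[y]scale1r Vq_bracket_linearr !scale1r. Qed.

Lemma Vq_brZl a (x y : V) : br (a *: x) y = a *: br x y.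
Proof. by rewrite Vq_bracketC Vq_brZr -scalerN (Vq_bracketC y x). Qed.

Lemma Vq_brDl (x y z : V) : br (x + y) z = br x z + br y z.
Proof.
by rewrite Vq_bracketC Vq_brDr opprD (Vq_bracketC z x) (Vq_bracketC z y).
Qed.

Lemma lambda_jacobi m n p : q != 0 ->
  lam n p * lam m (n + p) + lam p m * lam n (p + m) + lam m n * lam p (m + n)
  = 0.
Proof.
move=> q0; rewrite /lambda /= !mulrDr !expfzDr //.
rewrite [n.1 * m.2]mulrC [n.1 * p.2]mulrC [m.1 * n.2]mulrC [m.1 * p.2]mulrC.
rewrite [p.1 * m.2]mulrC [p.1 * n.2]mulrC.
by ring.
Qed.

Let addr_rot (a b c : V) : a + b + c = b + c + a.
Proof. by rewrite -addrA addrC. Qed.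

Let combine_linear a (u u' v v' w w' : V) :
  (a *: u + u') + (a *: v + v') + (a *: w + w')
  = a *: (u + v + w) + (u' + v' + w').
Proof. by rewrite [X in X + _ = _]addrACA [LHS]addrACA 2!scalerDr. Qed.

Let combine_scale a b c (w : V) :
  a + b + c = 0 -> a *: w + b *: w + c *: w = 0.
Proof. by move=> abc0; rewrite -2!scalerDl abc0 scale0r. Qed.

Lemma Vq_jacobi (x y z : V) : q != 0 ->
  br x (br y z) + br y (br z x) + br z (br x y) = 0.
Proof.
move=> q0; pose J x y z := br x (br y z) + br y (br z x) + br z (br x y).
have JC u v w : J u v w = J v w u.
  exact: addr_rot.
have Jlin v w : linear (fun u => J u v w).
  move=> a u u'; rewrite /J.
  rewrite (Vq_bracket_linearl (br v w)) (Vq_bracket_linearr w).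
  rewrite (Vq_bracket_linearr v) (Vq_bracket_linearl v) (Vq_bracket_linearr w).
  exact: combine_linear.
apply: (linear_eq0 (Jlin y z)) => m; rewrite JC.
apply: (linear_eq0 (Jlin z _)) => n; rewrite JC.
apply: (linear_eq0 (Jlin _ _)) => p; rewrite /J.
rewrite (Vq_bracketL m n) (Vq_bracketL n p) (Vq_bracketL p m).
rewrite 3!Vq_brZr (Vq_bracketL m) (Vq_bracketL n) (Vq_bracketL p) !scalerA.
have -> : m + (n + p) = p + (m + n) by rewrite addrA addrC.
have -> : n + (p + m) = p + (m + n) by rewrite addrCA [n + m]addrC.
apply: combine_scale; rewrite -[RHS](lambda_jacobi m n p q0); ring.
Qed.

Lemma Vq_lie_bracket : q != 0 -> 2%:R != 0 :> K -> is_lie_bracket br.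
Proof.
move=> q0 two_neq0; split.
- exact: Vq_bracket_linearl.
- exact: Vq_bracket_linearr.
- move=> x; apply/eqP; have /eqP := Vq_bracketC x x.
  rewrite -addr_eq0 -mulr2n -scaler_nat scaler_eq0.
  by rewrite (negPf two_neq0).
- by move=> x y z; exact: Vq_jacobi.
Qed.

End BracketTheory.

(* Main.v *)
Require Import Defs.
From mathcomp Require Import all_boot all_order all_algebra finmap.
From mathcomp Require Import complex monalg.
From mathcomp Require Import boolp classical_sets functions cardinality fsbigop.
From mathcomp Require Import reals.
From mathcomp Require Import ring.

Set Implicit Arguments.
Unset Strict Implicit.
Unset Printing Implicit Defensive.

Import Order.TTheory GRing.Theory Num.Theory.
Local Open Scope classical_set_scope.
Local Open Scope ring_scope.
Local Open Scope complex_scope.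

(** Write phi(L_m) = sum_i d_i(m) L_(m+i), with the convention L_0 = 0. The bracket is
graded by Z^2, so the half-derivation identity splits into one functional
equation for each shift i ([component_relation]):

  2 lambda(m,n) d_i(m+n) = lambda(m+i,n) d_i(m) + lambda(m,n+i) d_i(n),

together with the boundary value d_i(-i) = 0, which holds because L_0 = 0.
Since q is a primitive t-th root of unity, lambda is t-periodic in each
coordinate and lambda(m,n) vanishes exactly when t divides det(m,n)
([lambda_eq0]).

If i lies in (tZ)^2, periodicity turns the equation into the midpoint law
d(m) + d(n) = 2 d(m+n) whenever t does not divide det(m,n). Applied to pairs
taken from m, n, -m, -n, m+n, -(m+n), all of the same determinant up to sign,
it gives 3 (d(m) - d(n)) = 0. Hence d is constant on Gamma_2, any two points
of which are linked by a chain of such pairs ([lattice_const]). The constant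
is alpha^i. On Gamma_1 nothing has to be shown, as the coefficients there may
depend on m.

If i does not lie in (tZ)^2, then d_i = 0 ([off_eq0]). Putting m = -i in the
equation and using the boundary value, d(n+i) is 2 q^(i_1 i_2) d(n) when
det(i,n) is not divisible by t; after t steps d(n + t i) = 2^t d(n). But
lambda does not see the translation by t i, so the equation for the pair
(m, m + t i) reads (2^t - 1) d(m) = 0 up to a nonzero factor. This settles the
m with det(i,m) nonzero modulo t, and one further use of the equation reaches
all the others. *)

(** * Coordinates of a half-derivation *)

Section Coordinates.
Variables (K : fieldType) (q : K).
Local Notation V := (Vq K).
Local Notation Lv := (@Lvec K).
Local Notation br := (Vq_bracket q).
Local Notation lam := (lambda q).

(** Indexed by all of Z^2 rather than by Gamma, with value 0 at the origin, so that
the convention L_0 = 0 is built in and no case distinction on m + n = 0 arises. *)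
Definition Lcoef (x : V) (k : Z2) : K :=
  if insub k is Some g then x@_g else 0.

Lemma Lcoef0r x : Lcoef x 0 = 0.
Proof. by rewrite /Lcoef insubF. Qed.

Lemma Lcoef_val x (g : {m : Z2 | Gamma m}) : Lcoef x (val g) = x@_g.
Proof. by rewrite /Lcoef valK. Qed.

Lemma Lcoef_lin a x y k : Lcoef (a *: x + y) k = a * Lcoef x k + Lcoef y k.
Proof.
rewrite /Lcoef; case: insubP => [g _ _|_]; last by rewrite mulr0 addr0.
by rewrite mcoeffD mcoeffZ.
Qed.

Lemma Lcoef0l k : Lcoef 0 k = 0.
Proof. by rewrite /Lcoef; case: insubP => // g _ _; rewrite mcoeff0. Qed.

Lemma LcoefZ a x k : Lcoef (a *: x) k = a * Lcoef x k.
Proof. by rewrite -[a *: x]addr0 Lcoef_lin Lcoef0l addr0. Qed.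

Lemma LcoefD x y k : Lcoef (x + y) k = Lcoef x k + Lcoef y k.
Proof. by rewrite -[x]scale1r Lcoef_lin scale1r mul1r. Qed.

Lemma LcoefL m k : Lcoef (Lv m) k = ((m == k) && (k != 0))%:R.
Proof.
rewrite /Lcoef; case: insubP => [g k0 <-|]; last first.
  by rewrite /Gamma negbK => /eqP ->; rewrite eqxx andbF.
have -> : val g != 0 by exact: valP g.
rewrite andbT /Lvec; case: insubP => [h _ <-|].
  by rewrite mcoeffU (inj_eq val_inj).
rewrite /Gamma negbK => /eqP ->; rewrite mcoeff0.
by rewrite eq_sym (negbTE (valP g)).
Qed.

Lemma Vq_ind (P : V -> Prop) :
  P 0 -> (forall a m x, P x -> P (a *: Lv m + x)) -> forall x, P x.
Proof.
move=> P0 PS x; rewrite [x]Vq_decomp.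
elim: (msupp x : seq _) => [|g s IHs]; first by rewrite big_nil.
by rewrite big_cons; apply: PS.
Qed.

Lemma lambdaNl n : lam (- n) n = 0.
Proof. by rewrite /lambda /= !mulNr mulrC subrr. Qed.

(** Valid at k = 0 as well, where the basis vector is missing, because lambda(-n,n)
vanishes. *)
Lemma Lcoef_brL x n k : Lcoef (br x (Lv n)) k = lam (k - n) n * Lcoef x (k - n).
Proof.
elim/Vq_ind: x => [|a m x IHx].
  by rewrite /Vq_bracket msupp0 big_seq_fset0 !Lcoef0l mulr0.
rewrite Vq_brDl Vq_brZl Vq_bracketL !Lcoef_lin LcoefZ IHx mulrDr !LcoefL.
congr (_ + _); rewrite eq_sym -subr_eq [k - n == m]eq_sym.
case: (eqVneq m (k - n)) => [->|_]; last by rewrite !mulr0.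
have [->|k0] := eqVneq k 0; first by rewrite sub0r lambdaNl !mul0r mulr0.
have [->|_] := eqVneq (k - n) 0; first by rewrite lambda0l !mul0r mulr0.
by rewrite !mulr1 mulrC.
Qed.

Lemma Lcoef_Lbr x m k : Lcoef (br (Lv m) x) k = lam m (k - m) * Lcoef x (k - m).
Proof.
by rewrite Vq_bracketC -scaleN1r LcoefZ Lcoef_brL mulN1r -mulNr -lambda_antisym.
Qed.

Definition half_relation (i : Z2) (d : Z2 -> K) : Prop :=
  forall m n, 2%:R * (lam m n * d (m + n))
    = lam (m + i) n * d m + lam m (n + i) * d n.

Definition component (phi : V -> V) (i m : Z2) : K := Lcoef (phi (Lv m)) (m + i).

(** The identity for the pair (L_m, L_n), read at the basis vector L_(m+n+i). *)
Lemma component_relation (phi : {linear V -> V}) i : 2%:R != 0 :> K ->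
  half_derivation br phi -> half_relation i (component phi i).
Proof.
move=> two0 phi_half m n.
(* With f a plain function, the structures hidden in the type of phi stay out
   of the way of the rewriting below. *)
pose f : V -> V := phi.
have : lam m n *: f (Lv (m + n))
    = 2%:R^-1 *: (br (f (Lv m)) (Lv n) + br (Lv m) (f (Lv n))).
  rewrite -[RHS]phi_half Vq_bracketL; exact/esym/(linearZ_LR phi).
rewrite -/f; move: f => f {phi phi_half} /(congr1 (Lcoef^~ (m + n + i))) /=.
rewrite [X in X = _ -> _]LcoefZ [X in _ = X -> _]LcoefZ LcoefD.
rewrite [X in _ * (X + _)]Lcoef_brL [X in _ * (_ + X)]Lcoef_Lbr.
move=> /(congr1 ( *%R 2%:R)); rewrite mulVKf //.
have -> : m + n + i - n = m + i by rewrite addrAC addrK.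
by have -> : m + n + i - m = n + i by rewrite -(addrA m) [m + _]addrC addrK.
Qed.

Lemma componentN (phi : V -> V) i : component phi i (- i) = 0.
Proof. by rewrite /component addNr Lcoef0r. Qed.

(** A vector is the finitely supported sum of its coordinates, reindexed by the shift
i = k - m; this turns statements about components into the expansions sought. *)
Lemma Lvec_expansion (A : set Z2) (alpha : Z2 -> K) (m : Z2) x :
    (forall i, ~ A i -> Lcoef x (m + i) = 0) ->
    (forall i, A i -> alpha i = Lcoef x (m + i)) ->
  finite_set [set i | A i /\ alpha i != 0]
  /\ x = \sum_(i \in A) alpha i *: Lv (m + i).
Proof.
move=> xA alphaE; pose r : seq Z2 := [seq val g - m | g <- msupp x].
have uniq_r : uniq r.
  by rewrite map_inj_uniq ?fset_uniq // => g h /addIr; apply: val_inj.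
have mK (k : Z2) : m + (k - m) = k by rewrite addrC subrK.
have Ar i : i \in r -> A i.
  case/mapP => g gx ->; apply: contrapT => /xA.
  by rewrite mK Lcoef_val => /eqP; rewrite mcoeff_eq0 gx.
have out i : A i -> i \notin r -> alpha i = 0.
  move=> Ai; rewrite alphaE // /Lcoef; case: insubP => // g _ gE.
  apply: contraNeq; rewrite mcoeff_neq0 => ?.
  by apply/mapP; exists g => //; rewrite gE addrC addKr.
split.
  apply: (sub_finite_set _ (finite_seq r)) => i /= [Ai ai].
  by apply: contraNT ai => /(out _ Ai) ->.
rewrite (fsbigE r) //; last first.
  by move=> i Ai ir; rewrite out // scale0r.
rewrite /r big_map big_seq_cond [LHS](Vq_decomp x) [LHS]big_seq.
apply: eq_big => g.
  case: (boolP (g \in msupp x)) => //= gx.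
  by apply/esym/mem_set/Ar/map_f.
move=> gx; rewrite alphaE ?mK ?Lcoef_val //; exact/Ar/map_f.
Qed.

End Coordinates.

(** * The structure constants at a primitive root of unity *)

Definition det2 (m n : Z2) : int := m.1 * n.2 - m.2 * n.1.

Lemma Z2_mulrnE (i : Z2) k : i *+ k = (i.1 *+ k, i.2 *+ k).
Proof. by elim: k => // k IHk; rewrite !mulrSr IHk. Qed.

Lemma det2_steps i n k : det2 i (n + i *+ k) = det2 i n.
Proof. by rewrite /det2 Z2_mulrnE /= -(mulr_natr i.1) -(mulr_natr i.2); ring. Qed.

Section RootOfUnity.
Variables (K : numFieldType) (t : nat) (q : K).
Hypotheses (t_gt1 : (1 < t)%N) (q_prim : t.-primitive_root q).
Local Notation lam := (lambda q).

Let q_neq0 : q != 0.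
Proof. by rewrite (prim_root_eq0 q_prim) -lt0n ltnW. Qed.

Lemma prim_expz_eq1 (z : int) : (q ^ z == 1) = (t%:Z %| z)%Z.
Proof.
case: z => n; first by rewrite -exprnP -(prim_order_dvd q_prim).
by rewrite NegzE -exprnN invr_eq1 -(prim_order_dvd q_prim).
Qed.

Lemma prim_expz_eq (a b : int) : (q ^ a == q ^ b) = (t%:Z %| a - b)%Z.
Proof.
rewrite -prim_expz_eq1 -[RHS](inj_eq (mulIf (expfz_neq0 b q_neq0))).
by rewrite -expfzDr // subrK mul1r.
Qed.

Lemma lambda_eq0 m n : (lam m n == 0) = (t%:Z %| det2 m n)%Z.
Proof. by rewrite subr_eq0 eq_sym prim_expz_eq. Qed.

Lemma lambda_addr i m n : tZ2 t i -> lam m (n + i) = lam m n.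
Proof.
case/andP => i1 i2; congr (_ - _); apply/eqP; rewrite prim_expz_eq -mulrBr.
  by rewrite addrAC subrr add0r dvdz_mull.
by rewrite addrAC subrr add0r dvdz_mull.
Qed.

Lemma lambda_addl i m n : tZ2 t i -> lam (m + i) n = lam m n.
Proof.
by move=> ti; rewrite lambda_antisym lambda_addr // -lambda_antisym.
Qed.

Lemma lambda_shift i n : lam (- i) (n + i) = q ^ (- (i.1 * i.2)) * lam (- i) n.
Proof.
rewrite /lambda /= !mulrDr !expfzDr // !mulNr [i.2 * i.1]mulrC.
by ring.
Qed.

(** ** Shifts in the lattice *)

Section LatticeShift.
Variables (i : Z2) (d : Z2 -> K).
Hypotheses (i_lat : tZ2 t i) (d_rel : half_relation q i d).

(** Translation by i leaves lambda unchanged, so the three values of lambda in the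
functional equation agree and cancel. *)
Lemma lattice_midpoint m n : ~~ (t%:Z %| det2 m n)%Z ->
  d m + d n = 2%:R * d (m + n).
Proof.
rewrite -lambda_eq0 => l0; apply: (mulfI l0).
have := d_rel m n; rewrite lambda_addl // lambda_addr // => e.
by rewrite mulrDr -e mulrCA.
Qed.

(** Two midpoint laws centred at m and n express d(-m) - d(-n) as 2 (d(n) - d(m)); the
two centred at -m and -n express d(m) - d(n) as 2 (d(-n) - d(-m)). Together
d(m) - d(n) = 4 (d(m) - d(n)). *)
Lemma lattice_eq_det m n : ~~ (t%:Z %| det2 m n)%Z -> d m = d n.
Proof.
move=> mn.
have mid a b c : det2 a b = det2 m n \/ det2 a b = - det2 m n -> c = a + b ->
    d a + d b - 2%:R * d c = 0.
  move=> ab ->; apply/eqP; rewrite subr_eq0; apply/eqP/lattice_midpoint.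
  by case: ab => ->; rewrite ?rpredN.
have e1 : d (m + n) + d (- n) - 2%:R * d m = 0.
  by apply: mid; [right; rewrite /det2 /=; ring | rewrite addrK].
have e2 : d (m + n) + d (- m) - 2%:R * d n = 0.
  by apply: mid; [left; rewrite /det2 /=; ring | rewrite addrAC subrr add0r].
have e3 : d (- (m + n)) + d n - 2%:R * d (- m) = 0.
  by apply: mid; [right; rewrite /det2 /=; ring | rewrite opprD addrNK].
have e4 : d (- (m + n)) + d m - 2%:R * d (- n) = 0.
  by apply: mid; [left; rewrite /det2 /=; ring | rewrite opprD addrAC addNr add0r].
apply/eqP; rewrite -subr_eq0 -(mulrI_eq0 _ (mulfI (_ : 3%:R != 0))) ?pnatr_eq0 //.
apply/eqP; transitivity (2%:R * (d (m + n) + d (- m) - 2%:R * d n)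
  - 2%:R * (d (m + n) + d (- n) - 2%:R * d m)
  + (d (- (m + n)) + d n - 2%:R * d (- m))
  - (d (- (m + n)) + d m - 2%:R * d (- n))); first by ring.
by rewrite e1 e2 e3 e4; ring.
Qed.

(** Every m in Gamma_2 has nonzero determinant modulo t with (1,0) or with (0,1), and
these two are themselves such a pair. *)
Lemma lattice_const m n : Gamma2 t m -> Gamma2 t n -> d m = d n.
Proof.
suff d10 k : Gamma2 t k -> d k = d (1, 0) by move=> /d10-> /d10->.
rewrite /Gamma2 /tZ2 negb_and => k12.
have [k2|k2] := boolP (t%:Z %| k.2)%Z; last first.
  by apply/esym/lattice_eq_det; rewrite /det2 /= mul1r mul0r subr0.
rewrite k2 orbF in k12.
rewrite (@lattice_eq_det k (0, 1)); last by rewrite /det2 /= mulr1 mulr0 subr0.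
apply/esym/lattice_eq_det.
by rewrite /det2 /= mul1r mulr0 subr0 dvdzE /= dvdn1 neq_ltn t_gt1 orbT.
Qed.

End LatticeShift.

(** ** Shifts off the lattice *)

Section OffLatticeShift.
Variables (i : Z2) (d : Z2 -> K).
Hypotheses (i_off : ~~ tZ2 t i) (d_rel : half_relation q i d) (dN : d (- i) = 0).

(** The functional equation for the pair (-i, n+i): the term d(-i) drops out, and the
remaining factors of lambda differ by a power of q. *)
Lemma off_step n : ~~ (t%:Z %| det2 i n)%Z ->
  d (n + i) = 2%:R * q ^ (i.1 * i.2) * d n.
Proof.
move=> in0.
have l0 : lam (- i) n != 0.
  by rewrite lambda_eq0 -rpredN (_ : - _ = det2 i n) // /det2 /=; ring.
have := d_rel (- i) (n + i).
have -> : - i + (n + i) = n by rewrite addrC addrK.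
rewrite dN mulr0 add0r !lambda_shift => e.
have qz0 : q ^ (- (i.1 * i.2)) != 0 by rewrite expfz_neq0.
apply: (mulfI l0); apply: (mulfI qz0); apply: (mulfI qz0).
rewrite -[q ^ (i.1 * i.2)]invrK invr_expz.
transitivity (2%:R * (q ^ (- (i.1 * i.2)) * lam (- i) n * d n)); last by field.
by rewrite e; ring.
Qed.

Lemma off_steps n k : ~~ (t%:Z %| det2 i n)%Z ->
  d (n + i *+ k) = (2%:R * q ^ (i.1 * i.2)) ^+ k * d n.
Proof.
move=> in0; elim: k => [|k IHk]; first by rewrite addr0 mul1r.
rewrite mulrSr addrA off_step ?IHk ?exprS ?mulrA //.
by rewrite det2_steps.
Qed.

(** For the pair (m, m + t i) the left side of the functional equation vanishes because
lambda(m, m + t i) = lambda(m, m); on the right the two terms have opposite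
factors lambda, and d(m + t i) = 2^t d(m). *)
Lemma off_det_eq0 m : ~~ (t%:Z %| det2 i m)%Z -> d m = 0.
Proof.
move=> im.
have l0 : lam m (m + i) != 0.
  by rewrite lambda_eq0 -rpredN (_ : - _ = det2 i m) // /det2 /=; ring.
have tit : tZ2 t (i *+ t).
  by rewrite /tZ2 Z2_mulrnE /= -(mulr_natr i.1) -(mulr_natr i.2) natz !dvdz_mull.
have qt1 : (q ^ (i.1 * i.2)) ^+ t = 1.
  by rewrite exprnP exprzAC -[q ^ t]exprnP prim_expr_order // exp1rz.
have := d_rel m (m + i *+ t).
rewrite (addrAC m (i *+ t) i) !(lambda_addr _ _ tit) lambdaxx mul0r mulr0.
rewrite (lambda_antisym q m (m + i)) off_steps // exprMn.
rewrite qt1 mulr1 => e.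
have /eqP : lam m (m + i) * ((2%:R ^+ t - 1) * d m) = 0 by rewrite [RHS]e; ring.
rewrite !mulf_eq0 (negPf l0) /= => /orP[]; last by move/eqP.
by rewrite subr_eq0 -natrX pnatr_eq1 gtn_eqF // (ltn_trans t_gt1) // ltn_expl.
Qed.

(** When det(i,m) = 0 modulo t, pick n with det(i,n) nonzero, so that d vanishes at n,
m+n and m-n. If det(m,n) = 0, then det(m+i,n) is nonzero and the pair (m,n)
gives d(m) = 0; otherwise the pair (m-n,n) does. *)
Lemma off_eq0 m : d m = 0.
Proof.
have [n in0] : exists n, ~~ (t%:Z %| det2 i n)%Z.
  move: i_off; rewrite negb_and => /orP[h|h]; [exists (0, 1)|exists (1, 0)].
    by rewrite /det2 /= mulr1 mulr0 subr0.
  by rewrite /det2 /= mulr1 mulr0 sub0r rpredN.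
have [im|] := boolP (t%:Z %| det2 i m)%Z; last exact: off_det_eq0.
have dn := off_det_eq0 in0.
have dmn : d (m + n) = 0.
  apply: off_det_eq0; rewrite (_ : det2 i _ = det2 i m + det2 i n).
    by rewrite rpredDl.
  by rewrite /det2 /=; ring.
have dnm : d (m - n) = 0.
  apply: off_det_eq0; rewrite (_ : det2 i _ = det2 i m - det2 i n).
    by rewrite rpredDl // rpredN.
  by rewrite /det2 /=; ring.
have [mn|mn] := boolP (t%:Z %| det2 m n)%Z.
  have /eqP := d_rel m n.
  rewrite dn dmn !mulr0 addr0 eq_sym mulf_eq0 lambda_eq0.
  rewrite (_ : det2 _ _ = det2 m n + det2 i n); last by rewrite /det2 /=; ring.
  by rewrite rpredDl // (negPf in0) => /eqP.
have /eqP := d_rel (m - n) n.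
rewrite dn dnm !mulr0 addr0 subrK !mulf_eq0 pnatr_eq0 lambda_eq0.
rewrite (_ : det2 _ _ = det2 m n); last by rewrite /det2 /=; ring.
by rewrite (negPf mn) => /eqP.
Qed.

End OffLatticeShift.

End RootOfUnity.

(** * Half-derivations of the q-analog Virasoro-like algebra *)

Theorem theorem3p2 (R : realType) (t : nat) (q : R[i])
    (t_gt2 : (2 < t)%N) (q_prim : t.-primitive_root q)
    (phi : {linear Vq R[i] -> Vq R[i]})
    (phi_half : half_derivation (Vq_bracket q) phi) :
  exists (alpha : Z2 -> R[i]) (alpha_ : Z2 -> Z2 -> R[i]),
    [/\ finite_set [set i | Gamma1_0 t i /\ alpha i != 0],
        forall m, Gamma1 t m ->
          finite_set [set i | Gamma1_0 t i /\ alpha_ m i != 0],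
        forall m, Gamma2 t m ->
          phi (Lvec R[i] m)
          = \sum_(i \in Gamma1_0 t) alpha i *: Lvec R[i] (m + i)
      & forall m, Gamma1 t m ->
          phi (Lvec R[i] m)
          = \sum_(i \in Gamma1_0 t) alpha_ m i *: Lvec R[i] (m + i)].
Proof.
have t_gt1 : (1 < t)%N by exact: ltnW.
have Gamma1_0E i : Gamma1_0 t i <-> tZ2 t i.
  rewrite /Gamma1_0 /Gamma1 /=; split=> [[/andP[]//|->]|ti].
    by rewrite /tZ2 !dvdz0.
  by have [->|i0] := eqVneq i 0; [right|left; rewrite ti].
have two0 : 2%:R != 0 :> R[i] by rewrite pnatr_eq0.
have rel i := component_relation i two0 phi_half.
have off m i : ~ Gamma1_0 t i -> component phi i m = 0.
  move=> /Gamma1_0E /negP ti.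
  exact: (off_eq0 t_gt1 q_prim ti (rel i) (componentN phi i)).
have expand m alpha :=
  @Lvec_expansion _ (Gamma1_0 t) alpha m (phi (Lvec _ m)) (off m).
have G10 : Gamma2 t (1, 0).
  by rewrite /Gamma2 /tZ2 /= dvdzE /= dvdn1 gtn_eqF.
exists (fun i => component phi i (1, 0)), (fun m i => component phi i m).
split=> [|m _|m m2|m _].
- by have [] := expand (1, 0) _ (fun _ _ => erefl).
- by have [] := expand m _ (fun _ _ => erefl).
- apply: (expand m _ _).2 => i /Gamma1_0E ti.
  exact: (lattice_const t_gt1 q_prim ti (rel i) G10 m2).
- by have [] := expand m _ (fun _ _ => erefl).
Qed.
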